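(* Let $X$ be a completely regular Hausdorff space and let $M$ be a maximal ideal of $C(X)$. Then $M$ is countable strongly annihilated if and only if $M$ is both a $z^\circ$-ideal and a real maximal ideal.
   Context: $C(X)$ is the ring of all continuous real-valued functions on $X$. An ideal $I$ of a commutative ring $R$ with unity is called countable strongly annihilated if for each countable subset $\{a_1,a_2,\ldots\}$ of $I$ and each $b\in R\setminus I$ there exists $c\in R$ such that $ca_n=0$ for all $n$ but $cb\neq 0$. For $a\in R$, $P_a$ denotes the intersection of all minimal prime ideals of $R$ containing $a$ (the empty intersection being $R$). A proper ideal $I$ of $R$ is a $z^\circ$-ideal if $P_a\subseteq I$ for each $a\in I$. In $C(X)$ this is equivalent to: whenever $f\in I$, $g\in C(X)$ and $\mathrm{int}\,Z(f)=\mathrm{int}\,Z(g)$, then $g\in I$, where $Z(f)=\{x\in X: f(x)=0\}$. A maximal ideal $M$ of $C(X)$ is real if $C(X)/M\cong\mathbb{R}$. *)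

(* Defs.v *)
From HB Require Import structures.
From mathcomp Require Import all_boot all_order all_algebra.
From mathcomp Require Import generic_quotient ring_quotient.
From mathcomp Require Import all_classical all_reals all_analysis.
Import Order.TTheory GRing.Theory Num.Theory.
Import numFieldNormedType.Exports.

Set Implicit Arguments.
Unset Strict Implicit.
Unset Printing Implicit Defensive.

Local Open Scope classical_set_scope.
Local Open Scope ring_scope.
Local Open Scope quotient_scope.

(** Ideals of a commutative ring, proper or not. The [idealr] of
    [ring_quotient] are the proper ideals of a nonzero ring; the zero ring has
    to be allowed here because [C(X)] is zero when [X] is empty. Membership is
    boolean, but by classical reasoning ([asbool]) this is no restriction. *)
HB.mixin Record isIdeal (R : comPzRingType) (S : R -> bool) := {
  ideal_mull : forall a : R, {in S, forall u, a * u \in S}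
}.

#[short(type="ideal")]
HB.structure Definition Ideal (R : comPzRingType) :=
  {S of GRing.ZmodClosed R S & isIdeal R S}.

(** [quot_ring I] is the ring [R / I]. Its additive group is the library one;
    the ring structure given there to [Quotient.quot] needs an [idealr]. *)
Definition quot_ring (R : comPzRingType) (I : ideal R) : Type :=
  Quotient.quot I.

HB.instance Definition _ (R : comPzRingType) (I : ideal R) :=
  Choice.on (quot_ring I).
HB.instance Definition _ (R : comPzRingType) (I : ideal R) :=
  GRing.Zmodule.on (quot_ring I).
HB.instance Definition _ (R : comPzRingType) (I : ideal R) :=
  EqQuotient.on (quot_ring I).

Section QuotRing.
Variables (R : comPzRingType) (I : ideal R).
Local Notation Q := (quot_ring I).

Lemma quot_ring_eqE (x y : R) : (\pi_Q x = \pi_Q y) <-> (x - y \in I).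
Proof. by split=> [/eqP|xy]; [|apply/eqP]; rewrite -Quotient.idealrBE. Qed.

Definition quot_ring_one : Q := \pi_Q 1.
Definition quot_ring_mul (x y : Q) : Q := \pi_Q (repr x * repr y).

Lemma quot_ring_piD (x y : R) : \pi_Q (x + y) = \pi_Q x + \pi_Q y.
Proof. exact: (Quotient.pi_add I). Qed.

Lemma quot_ring_piM (x y : R) :
  \pi_Q (x * y) = quot_ring_mul (\pi_Q x) (\pi_Q y).
Proof.
have rI z : z - repr (\pi_Q z) \in I by apply/quot_ring_eqE; rewrite reprK.
apply/quot_ring_eqE; set x' := repr _; set y' := repr _.
rewrite -[x * y](addrNK (x * y')) -mulrBr -addrA -mulrBl rpredD//.
  exact/ideal_mull/rI.
by rewrite mulrC; exact/ideal_mull/rI.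
Qed.

Fact quot_ring_mulA : associative quot_ring_mul.
Proof.
move=> x y z; elim/quotW: x => x; elim/quotW: y => y; elim/quotW: z => z.
by rewrite -(quot_ring_piM y z) -(quot_ring_piM x y) -!quot_ring_piM mulrA.
Qed.

Fact quot_ring_mulC : commutative quot_ring_mul.
Proof. by move=> x y; rewrite /quot_ring_mul mulrC. Qed.

Fact quot_ring_mul1 : left_id quot_ring_one quot_ring_mul.
Proof. by move=> x; elim/quotW: x => x; rewrite -quot_ring_piM mul1r. Qed.

Fact quot_ring_mulDl : left_distributive quot_ring_mul +%R.
Proof.
move=> x y z; elim/quotW: x => x; elim/quotW: y => y; elim/quotW: z => z.
by rewrite -quot_ring_piD -!quot_ring_piM -quot_ring_piD mulrDl.
Qed.

HB.instance Definition _ :=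
  GRing.Zmodule_isComPzRing.Build Q quot_ring_mulA quot_ring_mulC
    quot_ring_mul1 quot_ring_mulDl.

End QuotRing.

Section Ideals.
Variable R : comPzRingType.
Implicit Types (I M P : ideal R) (a : R).

Definition is_proper_ideal I : Prop := 1 \notin I.

Definition is_maximal_ideal M : Prop :=
  is_proper_ideal M /\
  forall J : ideal R, is_proper_ideal J -> [set` M] `<=` [set` J] ->
    [set` J] = [set` M].

Definition is_prime_ideal P : Prop :=
  is_proper_ideal P /\ forall x y : R, x * y \in P -> x \in P \/ y \in P.

Definition is_minimal_prime_ideal P : Prop :=
  is_prime_ideal P /\
  forall Q : ideal R, is_prime_ideal Q -> [set` Q] `<=` [set` P] ->
    [set` Q] = [set` P].

(** The ideal usually written [P_a]; an empty [\bigcap] is the whole ring. *)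
Definition minimal_prime_hull a : set R :=
  \bigcap_(P in [set P | is_minimal_prime_ideal P /\ a \in P]) [set` P].

Definition is_z_circ_ideal I : Prop :=
  is_proper_ideal I /\ forall a, a \in I -> minimal_prime_hull a `<=` [set` I].

Definition countable_strongly_annihilated I : Prop :=
  forall A : set R, countable A -> A `<=` [set` I] ->
  forall b : R, b \notin I ->
  exists c : R, (forall a, A a -> c * a = 0) /\ c * b <> 0.

End Ideals.

(** The ring [C(X)]: [continuousType X R] with the pointwise operations. *)
Section ContinuousRing.
Variables (R : realType) (X : topologicalType).
Local Notation C := (continuousType X R).
Implicit Types f g h : C.

Lemma cts_addP f g : continuous (fun x => f x + g x).
Proof. by move=> x; apply: continuousD; exact: cts_fun. Qed.

Lemma cts_oppP f : continuous (fun x => - f x).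
Proof. by move=> x; apply: continuousN; exact: cts_fun. Qed.

Lemma cts_mulP f g : continuous (fun x => f x * g x).
Proof. by move=> x; apply: continuousM; exact: cts_fun. Qed.

Definition cts_zero : C := cst 0.
Definition cts_one : C := cst 1.
Definition cts_opp f : C := mkcts (@cts_oppP f).
Definition cts_add f g : C := mkcts (@cts_addP f g).
Definition cts_mul f g : C := mkcts (@cts_mulP f g).

Fact cts_addA : associative cts_add.
Proof. by move=> f g h; apply/continuousEP => x; exact: addrA. Qed.

Fact cts_addC : commutative cts_add.
Proof. by move=> f g; apply/continuousEP => x; exact: addrC. Qed.

Fact cts_add0 : left_id cts_zero cts_add.
Proof. by move=> f; apply/continuousEP => x; exact: add0r. Qed.

Fact cts_addN : left_inverse cts_zero cts_opp cts_add.
Proof. by move=> f; apply/continuousEP => x; exact: addNr. Qed.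

HB.instance Definition _ :=
  GRing.isZmodule.Build C cts_addA cts_addC cts_add0 cts_addN.

Fact cts_mulA : associative cts_mul.
Proof. by move=> f g h; apply/continuousEP => x; exact: mulrA. Qed.

Fact cts_mulC : commutative cts_mul.
Proof. by move=> f g; apply/continuousEP => x; exact: mulrC. Qed.

Fact cts_mul1 : left_id cts_one cts_mul.
Proof. by move=> f; apply/continuousEP => x; exact: mul1r. Qed.

Fact cts_mulDl : left_distributive cts_mul +%R.
Proof. by move=> f g h; apply/continuousEP => x; exact: mulrDl. Qed.

HB.instance Definition _ :=
  GRing.Zmodule_isComPzRing.Build C cts_mulA cts_mulC cts_mul1 cts_mulDl.

End ContinuousRing.

Definition is_real_maximal_ideal (R : realType) (X : topologicalType)
    (M : ideal (continuousType X R)) : Prop :=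
  is_maximal_ideal M /\
  exists phi : {rmorphism quot_ring M -> R}, bijective phi.

(* Main.v *)
Require Import Defs.
From HB Require Import structures.
From mathcomp Require Import all_boot all_order all_algebra.
From mathcomp Require Import generic_quotient lra.
From mathcomp Require Import all_classical all_reals all_analysis.
Import Order.TTheory GRing.Theory Num.Theory.
Import numFieldNormedType.Exports.

(** Write [Z f] for the zero set of [f]. Everything rests on two facts.

    In a reduced ring, an element of a minimal prime ideal is annihilated by
    some element outside that prime ([minimal_prime_annihilator]), and every
    nonzero element is missed by some minimal prime
    ([minimal_prime_not_mem]). Hence [b] lies outside the hull [P_a] exactly
    when some [c] satisfies [c * a = 0] and [c * b <> 0]: being a
    z-circ-ideal is strong annihilation for one element at a time
    ([z_circ_of_countable_strongly_annihilated], [z_circ_separation]).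

    Passing from one element to countably many is what reality provides. If
    [M] is real, evaluation in the residue field is a positive ring morphism
    [psi : C(X) -> R] with kernel [M], and positivity makes [M] closed under
    geometrically fast uniform limits from below ([real_maximal_limit]). A
    sequence [a_n] of [M] can thus be merged into the single element [f =
    \sum_n 2^-(n+1) a_n^2 / (1 + a_n^2)] of [M], whose zeros are common
    zeros of the [a_n] ([real_maximal_common_zero]); as [c * f = 0] then
    forces [c * a_n = 0] for all [n], separating [b] from [f] is enough.

    Conversely, a countable strongly annihilated ideal contains every function
    vanishing on a countable intersection of zero sets of its members
    ([annihilated_zero_set]): a [c] killing these members kills that function
    too. If [M] is maximal, hence prime, every [f] is then congruent to a
    constant modulo [M]. For each real [s], the functions vanishing exactly on
    [{f >= s}] and on [{f <= s}] can be chosen with product [0], so [M]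
    contains one of them; this is a Dedekind cut, its cut point [r] is finite
    because [M] is proper, and [Z (f - r)] is a countable intersection of such
    sets, whence [f - r \in M] ([annihilated_residue]). *)

Set Implicit Arguments.
Unset Strict Implicit.
Unset Printing Implicit Defensive.

Local Open Scope classical_set_scope.
Local Open Scope ring_scope.
Local Open Scope quotient_scope.

(** * Minimal prime ideals of reduced rings *)

Section ReducedRings.
Variable A : comPzRingType.
Implicit Types (a b c s t x y : A) (I M P Q : ideal A).

Lemma ideal_of_set (S : set A) :
    S 0 -> (forall x y, S x -> S y -> S (x + y)) ->
    (forall a x, S x -> S (a * x)) ->
  exists I : ideal A, forall x, x \in I <-> S x.
Proof.
move=> S0 SD SM; pose p : A -> bool := fun x => `[< S x >].
have inp x : (x \in p) = `[< S x >] by [].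
have p_zmod : GRing.zmod_closed p.
  split=> [|x y]; rewrite !inp; first exact/asboolP.
  move=> /asboolP Sx /asboolP Sy; apply/asboolP/SD => //.
  by rewrite -mulN1r; exact: SM.
have p_mul a : {in p, forall u, a * u \in p}.
  by move=> u; rewrite !inp => /asboolP Su; exact/asboolP/SM.
pose zp := GRing.isZmodClosed.Build A p p_zmod.
pose ip := isIdeal.Build A p p_mul.
pose I : ideal A := HB.pack p zp ip.
by exists I => x; split=> [/asboolP|?]; last exact/asboolP.
Qed.

(** If [a] is outside the maximal ideal [M], then [M + (a)] is not proper, and
    multiplying [1 = m + r * a] by [b] puts [b] in [M] as soon as [a * b] is. *)
Lemma maximal_ideal_prime M : is_maximal_ideal M -> is_prime_ideal M.
Proof.
move=> [Mproper Mmax]; split=> // a b abM.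
have [aM|aNM] := boolP (a \in M); [by left|right].
have [||| J JE] := @ideal_of_set
    [set x | exists2 m, m \in M & exists r, x = m + r * a].
- by exists 0; rewrite ?rpred0//; exists 0; rewrite mul0r addr0.
- move=> _ _ [m mM [r ->]] [n nM [s ->]]; exists (m + n); first exact: rpredD.
  by exists (r + s); rewrite mulrDl addrACA.
- move=> c _ [m mM [r ->]]; exists (c * m); first exact: ideal_mull.
  by exists (c * r); rewrite mulrDr mulrA.
have [/JE[m mM [r e]]|JNproper] := boolP (1 \in J).
  have -> : b = b * m + r * (a * b).
    by rewrite -[LHS]mulr1 e mulrDr mulrCA (mulrC b a).
  by rewrite rpredD// ideal_mull.
suff JM : [set` J] = [set` M].
  have : [set` J] a.
    by apply/JE; exists 0; rewrite ?rpred0//; exists 1; rewrite mul1r add0r.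
  by rewrite JM /= (negbTE aNM).
apply: Mmax => // x xM; apply/JE; exists x => //.
by exists 0; rewrite mul0r addr0.
Qed.

Hypothesis reduced : forall x, x * x = 0 -> x = 0.

(** A multiplicative set [T] containing [S] and maximal for avoiding [0] exists
    by Zorn's lemma. The elements killed by some element of [T] form an ideal
    disjoint from [T]; by maximality it is the whole complement of [T], hence
    prime. It is minimal because a prime inside it meets no element of [T] and
    so contains everything killed by [T]. *)
Lemma minimal_prime_avoiding (S : set A) :
    S 1 -> (forall s t, S s -> S t -> S (s * t)) -> ~ S 0 ->
  exists2 P, is_minimal_prime_ideal P & forall s, S s -> s \notin P.
Proof.
move=> S1 SM SN0.
(* The empty set is admitted so that the empty chain has an upper bound. *)
pose mulset (T : set A) :=
  [/\ forall s t, T s -> T t -> T (s * t), ~ T 0 & T = set0 \/ S `<=` T].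
have [F Fmul Ftot|T [[TM TN0 ST] Tmax]] := @Zorn_bigcup A mulset.
  split=> [s t [T FT Ts] [U FU Ut]|[T FT T0]|].
  - have [TU|UT] := Ftot _ _ FT FU.
      by exists U => //; have [UM _ _] := Fmul _ FU; apply: UM => //; exact: TU.
    by exists T => //; have [UM _ _] := Fmul _ FT; apply: UM => //; exact: UT.
  - by have [_ ] := Fmul _ FT.
  - have [[T FT ST]|noT] := pselect (exists2 T, F T & S `<=` T).
      by right=> s /ST Ts; exists T.
    left; rewrite -subset0 => s [T FT Ts]; apply: noT; exists T => //.
    by have [_ _ [T0|//]] := Fmul _ FT; move: Ts; rewrite T0.
have {}ST : S `<=` T.
  case: ST => // T0; exfalso; apply: (Tmax S).
    by rewrite T0; split=> // /(_ _ S1).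
  by split=> //; right.
have T1 : T 1 by exact: ST.
(* Adjoining [f] to [T] produces [0] unless [f] is in [T] already. *)
have TP f : ~ T f -> exists2 s, T s & f * s = 0.
  move=> fNT; apply: contrapT => fsN0.
  pose U := [set x | exists s n, T s /\ x = f ^+ n * s].
  have TU : T `<=` U by move=> s Ts; exists s, 0%N; rewrite mul1r.
  apply: (Tmax U).
    by split=> // UT; apply: fNT; apply: UT; exists 1, 1%N; rewrite mulr1.
  split=> [_ _ [s [m [Ts ->]]] [t [n [Tt ->]]]|[s [n [Ts /esym fns]]]|].
  - by exists (s * t), (m + n)%N; split; [exact: TM|rewrite exprD mulrACA].
  - case: n fns => [|n]; first by rewrite mul1r => s0; apply: TN0; rewrite -s0.
    move=> fns; apply: fsN0; exists s => //.
    elim: n fns => [//|n IHn fns]; apply: IHn; apply: reduced.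
    rewrite [RHS](_ : 0 = f ^+ n * s * (f ^+ n.+2 * s)).
      by rewrite [LHS]mulrACA [RHS]mulrACA -!exprD !(addSn, addnS).
    by rewrite fns mulr0.
  - by right=> s /ST/TU.
have [||| P PE] := @ideal_of_set [set f | exists2 s, T s & f * s = 0].
- by exists 1; rewrite ?mul0r.
- move=> f g [s Ts fs] [t Tt gt]; exists (s * t); first exact: TM.
  by rewrite mulrDl mulrA fs mul0r add0r mulrCA gt mulr0.
- by move=> a f [s Ts fs]; exists s; rewrite // -mulrA fs mulr0.
have PN s : T s -> s \notin P.
  by move=> Ts; apply/negP => /PE[t Tt st]; apply: TN0; rewrite -st; exact: TM.
have PP f : f \notin P -> T f.
  by move=> fP; apply: contrapT => /TP fs; move/negP: fP; apply; exact/PE.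
exists P; last by move=> s /ST/PN.
split; first split.
- exact: PN.
- move=> f g fgP; have [?|/PP Tf] := boolP (f \in P); first by left.
  have [?|/PP Tg] := boolP (g \in P); first by right.
  by move: (PN _ (TM _ _ Tf Tg)); rewrite fgP.
- move=> Q [_ Qprime] QP; apply/seteqP; split=> // f /PE[s /PN sP fs].
  have [|//|sQ] := Qprime f s; first by rewrite fs rpred0.
  by move: (QP _ sQ); rewrite /= (negbTE sP).
Qed.

(** In a reduced ring the powers of a nonzero element avoid [0]. *)
Lemma minimal_prime_not_mem x : x <> 0 ->
  exists2 P, is_minimal_prime_ideal P & x \notin P.
Proof.
move=> xN0.
have [||[n]|P Pmin PN] :=
    @minimal_prime_avoiding [set x ^+ n | n in setT].
- by exists 0%N.
- by move=> _ _ [m _ <-] [n _ <-]; exists (m + n)%N; rewrite ?exprD.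
- move=> _; elim: n => [|n IHn xn0].
    by rewrite expr0 => e; apply: xN0; rewrite -[x]mulr1 e mulr0.
  case: n => [|n] in IHn xn0; first by apply: xN0; rewrite -[x]expr1.
  apply: IHn; apply: reduced; rewrite -exprD addSnnS exprD xn0.
  by rewrite mulr0.
- by exists P => //; apply: PN; exists 1%N.
Qed.

(** Without such a [c], the products [c * f ^+ n] with [c] outside [P] would
    avoid [0]; a prime avoiding them would be a prime inside [P] missing [f],
    against the minimality of [P]. *)
Lemma minimal_prime_annihilator P f : is_minimal_prime_ideal P -> f \in P ->
  exists2 c, c \notin P & c * f = 0.
Proof.
move=> [[P1 Pprime] Pmin] fP; apply: contrapT => noc.
have PM c d : c \notin P -> d \notin P -> c * d \notin P.
  by move=> cP dP; apply/negP => /Pprime[]; apply/negP.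
have [||[c [n [cP cfn]]]|Q Qmin QN] :=
    @minimal_prime_avoiding [set x | exists c n, c \notin P /\ c * f ^+ n = x].
- by exists 1, 0%N; rewrite mulr1.
- move=> _ _ [c [m [cP <-]]] [d [n [dP <-]]]; exists (c * d), (m + n)%N.
  by split; [exact: PM|rewrite exprD mulrACA].
- case: n => [|n] in cfn.
    by move: cP; rewrite -[c]mulr1 -[1](expr0 f) cfn rpred0.
  apply: noc; exists c => //; elim: n cfn => [//|n IHn cfn]; apply: IHn.
  apply: reduced; rewrite [RHS](_ : 0 = c * f ^+ n * (c * f ^+ n.+2)).
    by rewrite [LHS]mulrACA [RHS]mulrACA -!exprD !(addSn, addnS).
  by rewrite cfn mulr0.
- have QP : [set` Q] `<=` [set` P].
    move=> x xQ; rewrite /=; apply: contrapT => /negP xP.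
    have : x \notin Q by apply: QN; exists x, 0%N; rewrite mulr1.
    by rewrite (_ : x \in Q).
  have QEP := Pmin Q Qmin.1 QP.
  have : f \notin Q by apply: QN; exists 1, 1%N; rewrite mul1r.
  by move/negP; apply; have : [set` P] f by []; rewrite -QEP.
Qed.

(** If [c] separates [b] from [a], a minimal prime missing [c * b] contains [a]
    but not [b], so [b] is not in the hull of [a]. *)
Lemma z_circ_of_countable_strongly_annihilated I : is_proper_ideal I ->
  countable_strongly_annihilated I -> is_z_circ_ideal I.
Proof.
move=> Iproper Icsa; split=> // a aI b ab.
rewrite /=; apply: contrapT => /negP bI.
have [||c [ca cb]] := Icsa [set a] _ _ _ bI; first exact: countable1.
  by move=> _ ->.
have [P Pmin cbP] := minimal_prime_not_mem cb.
have cP : c \notin P by apply: contra cbP => cP; rewrite mulrC ideal_mull.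
case: (Pmin) => -[_ Pprime] _.
have aP : a \in P.
  by have [|/negPn|//] := Pprime c a; rewrite ?(negbTE cP)// ca// rpred0.
by move: cbP; rewrite ideal_mull//; apply: ab.
Qed.

(** Some minimal prime contains [f] but not [b]; any annihilator of [f] outside
    this prime separates, since the prime does not contain [c * b] either. *)
Lemma z_circ_separation I f b : is_z_circ_ideal I -> f \in I -> b \notin I ->
  exists2 c, c * f = 0 & c * b <> 0.
Proof.
move=> [_ Iz] fI bI.
have [|P] := pselect
  (exists2 P, is_minimal_prime_ideal P & f \in P /\ b \notin P).
  move=> [P Pmin [fP bP]]; have [c cP cf] := minimal_prime_annihilator Pmin fP.
  exists c => // cb; have [[_ Pprime] _] := Pmin.
  have := Pprime c b.
  by rewrite cb rpred0 (negbTE cP) (negbTE bP) => /(_ isT)[].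
exfalso; move/negP: bI; apply; apply: (Iz f fI) => Q [Qmin fQ].
by rewrite /=; apply: contrapT => /negP bQ; apply: P; exists Q.
Qed.

End ReducedRings.

(** * Continuous functions with prescribed zeros and limits *)

Lemma le0_bounded_multiples (R : realType) (t : R) :
  (forall n, t * n%:R <= 1) -> t <= 0.
Proof.
move=> tn; rewrite leNgt; apply/negP => t0.
have := archi_boundP (ltW (divr_gt0 ltr01 t0)).
by rewrite ltr_pdivrMr// mulrC ltNge tn.
Qed.

Section ContinuousFunctions.
Variables (R : realType) (X : topologicalType).
Local Notation C := (continuousType X R).
Implicit Types (f g h : C) (M : ideal C).

Lemma cts_reduced f : f * f = 0 -> f = 0.
Proof.
move=> /continuousEP ff; apply/continuousEP => x.
by have /eqP := ff x; rewrite mulf_eq0 orbb => /eqP.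
Qed.

Definition cts_const (r : R) : C := cst r.

Lemma cts_norm_subproof f : continuous (fun x => `|f x|).
Proof. by move=> x; apply: cvg_norm; exact: cts_fun. Qed.

Definition cts_norm f : C := mkcts (@cts_norm_subproof f).

Lemma cts_sqrt_subproof f : continuous (fun x => Num.sqrt (f x)).
Proof.
by move=> x; apply: continuous_comp; [exact: cts_fun|exact: sqrt_continuous].
Qed.

Definition cts_sqrt f : C := mkcts (@cts_sqrt_subproof f).

Lemma cts_damp_subproof f : continuous (fun x => f x / (1 + f x * f x)).
Proof.
move=> x; apply: continuousM; first exact: cts_fun.
apply: continuousV; first by rewrite gt_eqF// ltr_pwDl// -expr2 sqr_ge0.
by apply: continuousD; [exact: cst_continuous|exact: (@cts_mulP _ _ f f)].
Qed.

(** [f * cts_damp f] has the zeros of [f] and takes its values in [[0, 1]], and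
    it is a multiple of [f], so it stays in any ideal containing [f]. *)
Definition cts_damp f : C := mkcts (@cts_damp_subproof f).

Lemma mul_damp_itv f x : 0 <= (f * cts_damp f) x <= 1.
Proof.
rewrite -[(f * _) x]/(f x * (f x / (1 + f x * f x))) mulrA.
have ff0 : 0 <= f x * f x by rewrite -expr2 sqr_ge0.
by rewrite divr_ge0 ?addr_ge0//= ler_pdivrMr ?ltr_pwDl// mul1r lerDr.
Qed.

Lemma mul_damp_eq0 f x : (f * cts_damp f) x = 0 -> f x = 0.
Proof.
have ff0 : 0 < 1 + f x * f x by rewrite ltr_pwDl// -expr2 sqr_ge0.
move=> /eqP; rewrite -[(f * _) x]/(f x * (f x / (1 + f x * f x))).
rewrite !mulf_eq0 invr_eq0.
by rewrite (gt_eqF ff0) orbF orbb => /eqP.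
Qed.

(** The partial sums increase and the [S n + 2^-n] decrease, so the supremum of
    the [S n] lies between the two; the limit is uniform, hence continuous. *)
Lemma cts_geometric_limit (S : nat -> C) :
    (forall n x, 0 <= S n.+1 x - S n x <= (2^-1) ^+ n.+1) ->
  exists f, forall n x, 0 <= f x - S n x <= (2^-1) ^+ n.
Proof.
move=> Sstep; pose f x := sup (range (S^~ x)).
have h0 n : 0 < 2^-1 ^+ n :> R by rewrite exprn_gt0.
have hS n : 2^-1 ^+ n = 2^-1 ^+ n.+1 + 2^-1 ^+ n.+1 :> R by rewrite exprS; lra.
have Sbnd m n x : S m x <= S n x + 2^-1 ^+ n.
  have Smono i j : (i <= j)%N -> S i x <= S j x.
    elim: j => [|j IHj]; first by rewrite leqn0 => /eqP ->.
    rewrite leq_eqVlt => /predU1P[->//|/IHj].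
    by have := Sstep j x; lra.
  have Santi i j : (i <= j)%N -> S j x + 2^-1 ^+ j <= S i x + 2^-1 ^+ i.
    elim: j => [|j IHj]; first by rewrite leqn0 => /eqP ->.
    rewrite leq_eqVlt => /predU1P[->//|/IHj].
    by have := Sstep j x; have := hS j; lra.
  have [/Smono|/ltnW/Santi] := leqP m n; first by have := h0 n; lra.
  by have := h0 m; lra.
have fS n x : 0 <= f x - S n x <= 2^-1 ^+ n.
  have ne : range (S^~ x) !=set0 by exists (S 0%N x), 0%N.
  have ub k : ubound (range (S^~ x)) (S k x + 2^-1 ^+ k) by move=> _ [m _ <-].
  have le1 : S n x <= f x.
    by apply: ub_le_sup; [exists (S 0%N x + 2^-1 ^+ 0)|exists n].
  have le2 : f x <= S n x + 2^-1 ^+ n by apply: ge_sup.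
  by lra.
have fc : continuous f.
  move=> x; apply/cvgrPdist_lt => e e0.
  have [n ne] : exists n, 2^-1 ^+ n < e / 2 :> R.
    have /cvgrPdist_lt/(_ (e / 2)) : (fun n => 2^-1 ^+ n : R) @ \oo --> 0.
      by apply: cvg_expr; rewrite ger0_norm; lra.
    case=> [|n _ /(_ n (leqnn n))]; first lra.
    by rewrite /= sub0r normrN ger0_norm; [exists n|exact: ltW].
  have /cvgrPdist_lt/(_ (e / 2)) : S n y @[y --> x] --> S n x by exact: cts_fun.
  move=> /(_ _); have e20 : 0 < e / 2 by lra.
  move=> /(_ e20); apply: filterS => y.
  by rewrite !ltr_norml; have := fS n x; have := fS n y; lra.
by exists (mkcts fc).
Qed.

(** * Real maximal ideals *)

(** The constants then map bijectively onto the quotient, by a ring morphism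
    which is injective because [M] is proper; its inverse is the required
    isomorphism. *)
Lemma residues_real_maximal M : is_maximal_ideal M ->
  (forall f, exists r, f - cts_const r \in M) -> is_real_maximal_ideal M.
Proof.
move=> Mmax Mres; split=> //; set Q := quot_ring M.
pose rho (r : R) : Q := \pi_Q (cts_const r).
have rho_eq r s : rho r = rho s -> r = s.
  move=> /quot_ring_eqE rsM; apply: contrapT => /eqP; rewrite -subr_eq0 => rs0.
  move: Mmax => [/negP + _]; apply.
  rewrite (_ : 1 = cts_const (r - s)^-1 * (cts_const r - cts_const s)).
    exact: ideal_mull.
  by apply/continuousEP => x; exact/esym/mulVf.
have rho_surj q : exists r, rho r = q.
  elim/quotW: q => f; have [r frM] := Mres f; exists r.
  by apply/esym/quot_ring_eqE.
pose phi q := sval (cid (rho_surj q)).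
have phiK : cancel phi rho by move=> q; exact: svalP (cid (rho_surj q)).
have rhoK : cancel rho phi by move=> r; apply: rho_eq; rewrite phiK.
have rhoD r s : rho (r + s) = rho r + rho s.
  by rewrite -quot_ring_piD; congr (\pi_Q _); exact/continuousEP.
have rhoM r s : rho (r * s) = rho r * rho s.
  by rewrite -[RHS]quot_ring_piM; congr (\pi_Q _); exact/continuousEP.
have rho1 : rho 1 = 1 by [].
have phi_add : zmod_morphism phi.
  move=> p q; apply: rho_eq; apply: (addIr q).
  by rewrite phiK subrK -{2}[q]phiK -rhoD subrK phiK.
have phi_mul : monoid_morphism phi.
  split=> [|p q]; apply: rho_eq; rewrite phiK ?rho1//.
  by rewrite rhoM !phiK.
pose phi_a := GRing.isZmodMorphism.Build _ _ phi phi_add.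
pose phi_m := GRing.isMonoidMorphism.Build _ _ phi phi_mul.
pose phi_rm : {rmorphism Q -> R} := HB.pack phi phi_a phi_m.
by exists phi_rm; exists rho.
Qed.

Lemma real_maximal_kernel M : is_real_maximal_ideal M ->
  exists psi : {rmorphism C -> R}, forall f, f \in M <-> psi f = 0.
Proof.
move=> [_ [phi phi_bij]]; set Q := quot_ring M.
have pi_add : zmod_morphism (\pi_Q : C -> Q).
  by move=> f g; apply: (addIr (\pi_Q g)); rewrite -quot_ring_piD !subrK.
have pi_mul : monoid_morphism (\pi_Q : C -> Q).
  by split=> // f g; exact: quot_ring_piM.
pose pi_a := GRing.isZmodMorphism.Build _ _ (\pi_Q : C -> Q) pi_add.
pose pi_m := GRing.isMonoidMorphism.Build _ _ (\pi_Q : C -> Q) pi_mul.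
pose pi_rm : {rmorphism C -> Q} := HB.pack (\pi_Q : C -> Q) pi_a pi_m.
exists (phi \o pi_rm) => f /=.
rewrite -[f in f \in M]subr0 -quot_ring_eqE (_ : \pi_Q 0 = 0); last first.
  exact: (rmorph0 pi_rm).
split=> [->|]; first exact: rmorph0.
by rewrite -[RHS](rmorph0 phi) => /(bij_inj phi_bij).
Qed.

(** A nonnegative function is a square, and so is its image. *)
Lemma rmorph_cts_ge0 (psi : {rmorphism C -> R}) f :
  (forall x, 0 <= f x) -> 0 <= psi f.
Proof.
move=> f0; have -> : f = cts_sqrt f * cts_sqrt f.
  by apply/continuousEP => x; rewrite -[RHS]expr2 sqr_sqrtr.
by rewrite rmorphM -expr2 sqr_ge0.
Qed.

(** With [psi] the evaluation of kernel [M], positivity applied to [f - S n] and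
    to [1 - (f - S n) * 2 ^+ n] gives [0 <= psi f] and [psi f * 2 ^+ n <= 1] for
    all [n]. *)
Lemma real_maximal_limit M (S : nat -> C) f : is_real_maximal_ideal M ->
    (forall n, S n \in M) -> (forall n x, 0 <= f x - S n x <= (2^-1) ^+ n) ->
  f \in M.
Proof.
move=> /real_maximal_kernel[psi psiM] SM fS; apply/psiM.
have psiS n : psi (f - S n) = psi f.
  by rewrite rmorphB ((psiM (S n)).1 (SM n)) subr0.
have psi0 : 0 <= psi f.
  rewrite -(psiS 0%N); apply: rmorph_cts_ge0 => x.
  by have /andP[] := fS 0%N x.
apply/eqP; rewrite eq_le psi0 andbT; apply: le0_bounded_multiples => n.
apply: (@le_trans _ _ (psi f * 2 ^+ n)).
  by rewrite ler_wpM2l// -natrX ler_nat ltnW// ltn_expl.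
have : 0 <= psi (1 - (f - S n) * 2 ^+ n).
  apply: rmorph_cts_ge0 => x.
  rewrite -[X in 0 <= X]/(1 - (f x - S n x) * ((2 : C) ^+ n) x).
  have -> : ((2 : C) ^+ n) x = 2 ^+ n.
    elim: n => [//|n IHn]; rewrite !exprS -IHn.
    by rewrite -[LHS]/((1 + 1 : R) * ((2 : C) ^+ n) x).
  rewrite subr_ge0 -ler_pdivlMr ?exprn_gt0// mul1r -exprVn.
  by have /andP[] := fS n x.
by rewrite rmorphB rmorph1 rmorphM rmorphXn rmorph_nat psiS subr_ge0.
Qed.

(** The function [f] is the sum of the series
    [\sum_n 2^-(n+1) a_n^2 / (1 + a_n^2)], whose terms are nonnegative and whose
    partial sums belong to [M]. *)
Lemma real_maximal_common_zero M (a : nat -> C) : is_real_maximal_ideal M ->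
    (forall n, a n \in M) ->
  exists2 f, f \in M & forall x, f x = 0 -> forall n, a n x = 0.
Proof.
move=> Mreal aM; pose g n := cts_const (2^-1 ^+ n.+1) * (a n * cts_damp (a n)).
pose S n := \sum_(k < n) g k.
have Sg n x : S n.+1 x - S n x = 2^-1 ^+ n.+1 * (a n * cts_damp (a n)) x.
  rewrite /S big_ord_recr /=; set s := \sum_(i < n) _.
  by rewrite -[(s + g n) x]/(s x + g n x) addrAC subrr add0r.
have h0 n : 0 < 2^-1 ^+ n :> R by rewrite exprn_gt0.
have [n x|f fS] := @cts_geometric_limit S.
  rewrite Sg; have /andP[d0 d1] := mul_damp_itv (a n) x.
  by rewrite mulr_ge0 ?(ltW (h0 _))//= ler_piMr// ltW.
exists f => [|x fx0 n].
  apply: real_maximal_limit Mreal _ fS => n; apply: rpred_sum => k _.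
  by rewrite ideal_mull// mulrC ideal_mull.
(* The [n]-th term is squeezed between [0] and [f x - S n x]. *)
apply: mul_damp_eq0; apply/eqP.
rewrite -(mulrI_eq0 _ (lregP (lt0r_neq0 (h0 n.+1)))) -Sg.
have S0 : 0 <= S n x.
  elim: n => [|n IHn]; first by rewrite /S big_ord0.
  have := Sg n x; have /andP[d0 d1] := mul_damp_itv (a n) x.
  by have := mulr_ge0 (ltW (h0 n.+1)) d0; lra.
have := fS n.+1 x; have := Sg n x; have /andP[d0 d1] := mul_damp_itv (a n) x.
have := mulr_ge0 (ltW (h0 n.+1)) d0; rewrite fx0 => *.
by apply/eqP; lra.
Qed.

(** * Countable strongly annihilated ideals of continuous functions *)

(** If [g] were not in [M], some [c] would kill all [a n] but not [g]; yet
    wherever [c] is nonzero all [a n] vanish, and so does [g]. *)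
Lemma annihilated_zero_set M (a : nat -> C) g :
    countable_strongly_annihilated M ->
    (forall n, a n \in M) -> (forall x, (forall n, a n x = 0) -> g x = 0) ->
  g \in M.
Proof.
move=> Mcsa aM ag; apply: contrapT => /negP gM.
have [||c [ca cg]] := Mcsa (range a) _ _ _ gM.
- by apply: sub_countable (card_image_le _ _) _; exact: countableP.
- by move=> _ [n _ <-]; exact: aM.
apply: cg; apply/continuousEP => x.
have [cx0|/eqP cx0] := pselect (c x = 0).
  by rewrite -[LHS]/(c x * g x) cx0 mul0r.
rewrite -[LHS]/(c x * g x) ag ?mulr0// => n; apply: (mulfI cx0); rewrite mulr0.
have /continuousEP/(_ x) := ca (a n) (imageT a n); exact.
Qed.

(** The residue is the supremum of the [s] for which [M] contains a function
    vanishing exactly where [s <= f]. *)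
Lemma annihilated_residue M f :
    is_maximal_ideal M -> countable_strongly_annihilated M ->
  exists r, f - cts_const r \in M.
Proof.
move=> Mmax Mcsa; have [M1 Mprime] := maximal_ideal_prime Mmax.
pose d s := f - cts_const s.
(* [u s] vanishes exactly where [s <= f], and [v s] where [f <= s]. *)
pose u s := d s - cts_norm (d s); pose v s := d s + cts_norm (d s).
have uE s x : u s x = f x - s - `|f x - s| by [].
have vE s x : v s x = f x - s + `|f x - s| by [].
have uvM s : u s \in M \/ v s \in M.
  apply: Mprime; rewrite (_ : u s * v s = 0) ?rpred0//.
  apply/continuousEP => x; rewrite -[LHS]/(u s x * v s x) uE vE -subr_sqr.
  by rewrite real_normK ?num_real// subrr.
have u0 s x : u s x = 0 <-> s <= f x.
  rewrite uE; split=> [|sf]; last by rewrite ger0_norm; lra.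
  by have := normr_ge0 (f x - s); lra.
have v0 s x : v s x = 0 <-> f x <= s.
  rewrite vE; split=> [|sf]; last by rewrite ler0_norm; lra.
  by have := normr_ge0 (f x - s); lra.
have natNbnd (y : R) : ~ forall n : nat, n%:R <= y.
  move=> /(_ (Num.bound `|y|)); have := archi_boundP (normr_ge0 y).
  by have := ler_norm y; lra.
pose L := [set s | u s \in M].
have Ldown s t : L s -> t <= s -> L t.
  move=> Ls ts; apply: (annihilated_zero_set (a := fun=> u s)) Mcsa _ _ => // x.
  by move=> /(_ 0%N); rewrite !u0; apply: le_trans.
(* If [L] is empty, the [v (- n)] are in [M]; at a common zero, [f] would be
   below every [- n], so [1] vanishes wherever they all do. *)
have L0 : L !=set0.
  apply: contrapT => Lempty; move/negP: M1; apply.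
  apply: (annihilated_zero_set (a := fun n => v (- n%:R))) Mcsa _ _ => [n|x].
    by have [uM|//] := uvM (- n%:R); case: Lempty; exists (- n%:R).
  move=> vx; case: (natNbnd (- f x)) => n.
  by have /v0 := vx n; lra.
have Lub : has_ubound L.
  apply: contrapT => Lnub; move/negP: M1; apply.
  apply: (annihilated_zero_set (a := fun n => u n%:R)) Mcsa _ _ => [n|x].
    apply: contrapT => nL; apply: Lnub; exists n%:R => s Ls.
    by rewrite leNgt; apply/negP => /ltW /(Ldown _ _ Ls).
  by move=> ux; case: (natNbnd (f x)) => n; exact/u0.
exists (sup L).
pose e n : R := n.+1%:R^-1.
have e0 n : 0 < e n by rewrite invr_gt0.
(* As [u <= 0 <= v], a difference [v _ - u _] vanishes only where both terms do. *)
apply: (annihilated_zero_set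
  (a := fun n => v (sup L + e n) - u (sup L - e n))) Mcsa _ _ => [n|x].
  apply: rpredB.
    have [uM|//] := uvM (sup L + e n).
    by have := ub_le_sup Lub uM; have := e0 n; lra.
  have [s Ls] := sup_adherent (e0 n) (conj L0 Lub).
  by move=> /ltW; exact: Ldown.
move=> vux; have bnd n : `|f x - sup L| <= e n.
  pose s := sup L + e n; pose t := sup L - e n.
  have : v s x - u t x = 0 := vux n.
  rewrite vE uE => vu.
  have vx0 : v s x = 0.
    rewrite vE; have := ler_norm (f x - t); have := normr_ge0 (f x - s).
    by have := ler_norm (- (f x - s)); rewrite normrN; lra.
  have ux0 : u t x = 0 by move: vx0 vu; rewrite uE vE; lra.
  by move: vx0 ux0 => /v0 + /u0; rewrite /s /t ler_norml; lra.
rewrite -[LHS]/(f x - sup L); apply/eqP; rewrite -normr_le0.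
apply: le0_bounded_multiples => -[|n]; first by rewrite mulr0.
by rewrite -ler_pdivlMr// mul1r; exact: bnd.
Qed.

End ContinuousFunctions.

Theorem proposition4p4 (R : realType) (X : topologicalType)
    (X_creg : completely_regular_space X) (X_haus : hausdorff_space X)
    (M : ideal (continuousType X R)) (M_max : is_maximal_ideal M) :
  countable_strongly_annihilated M <-> (is_z_circ_ideal M /\ is_real_maximal_ideal M).
Proof.
split=> [Mcsa|[Mz Mreal] B Bcount BM b bM].
  split.
    apply: z_circ_of_countable_strongly_annihilated Mcsa; last by case: M_max.
    exact: cts_reduced.
  by apply: residues_real_maximal => // f; exact: annihilated_residue.
have /countable_injP[e e_inj] := Bcount.
(* Enumerate [B], with the value [0] at the unused indices. *)
have /choice[a aE] n : exists h : continuousType X R,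
    (exists2 g, B g & e g = n /\ h = g) \/
    ~ (exists2 g, B g & e g = n) /\ h = 0.
  have [[g Bg eg]|noe] := pselect (exists2 g, B g & e g = n).
    by exists g; left; exists g.
  by exists 0; right.
have aM n : a n \in M.
  by have [[g /BM gM [_ ->]]|[_ ->]] := aE n; rewrite ?rpred0.
have Ba g : B g -> a (e g) = g.
  move=> Bg; have [[h Bh [eh ->]]|[[]]] := aE (e g); last by exists g.
  by apply: e_inj; rewrite ?inE.
have [f fM fa] := real_maximal_common_zero Mreal aM.
have [c cf cb] := z_circ_separation (@cts_reduced R X) Mz fM bM.
exists c; split=> // g /Ba <-; apply/continuousEP => x.
rewrite -[LHS]/(c x * a (e g) x).
have /continuousEP/(_ x)/eqP := cf; rewrite -[(c * f) x]/(c x * f x) mulf_eq0.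
by case/orP => /eqP; [move=> ->; rewrite mul0r|move=> /fa ->; rewrite mulr0].
Qed.
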